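(* Let $R$ be an infinite SPIR and let $p,n$ be two integers such that $1<p<n$. Then: (1) If $n=p+1$, every injective $R$-algebra morphism $\varphi:R^p\to R^n$ has FIP. (2) If $p+2\leq n\leq 2p$, then some injective $R$-algebra morphisms $\varphi:R^p\to R^n$ have FIP and some others do not have FIP. (3) If $n\geq 2p+1$, then no injective $R$-algebra morphism $\varphi:R^p\to R^n$ has FIP.
   Context: All rings are commutative, unital and nonzero; ring morphisms are unital. A special principal ideal ring (SPIR) is a principal ideal ring $R$ with a unique prime ideal $M=Rt$, where $M$ is nonzero and nilpotent (so a SPIR is not a field). $R^p$ and $R^n$ carry their canonical (diagonal) $R$-algebra structures. An injective ring morphism $\varphi:A\to B$ is said to have FIP if the set of subrings $T$ of $B$ with $\varphi(A)\subseteq T\subseteq B$ is finite. *)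

(* Defs.v *)
From HB Require Import structures.
From mathcomp Require Import all_boot all_order all_algebra.
From mathcomp Require Import all_classical.

Set Implicit Arguments.
Unset Strict Implicit.
Unset Printing Implicit Defensive.

Import GRing.Theory.
Local Open Scope classical_set_scope.
Local Open Scope ring_scope.

Section Ideals.
Variable R : comNzRingType.
Implicit Types (I J P : set R) (t : R).

(* Ideals of R are the R-submodules of R^o.  In contrast, MathComp's
   idealr_closed, used for prime ideals below, forces properness. *)
Definition is_ideal I : Prop := GRing.submod_closed ([in I] : {pred R^o}).

Definition is_prime_ideal P : Prop :=
  idealr_closed [in P] /\ prime_idealr_closed [in P].

Definition principal_ideal t : set R := range (fun a => a * t).

Definition ideal_mul I J : set R :=
  [set x | exists m (a b : 'I_m -> R),
     [/\ forall i, I (a i), forall i, J (b i) & x = \sum_(i < m) a i * b i]].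

Definition ideal_exp I (k : nat) : set R := iter k (ideal_mul I) [set: R].

Definition nilpotent_ideal I : Prop := exists k, ideal_exp I k = [set 0].

End Ideals.

Definition principal_ideal_ring (R : comNzRingType) : Prop :=
  forall I : set R, is_ideal I -> exists t, I = principal_ideal t.

Definition SPIR (R : comNzRingType) : Prop :=
  principal_ideal_ring R /\
  exists t : R,
    [/\ is_prime_ideal (principal_ideal t),
        forall P : set R, is_prime_ideal P -> P = principal_ideal t,
        principal_ideal t <> [set 0]
      & nilpotent_ideal (principal_ideal t)].

Definition FIP (A B : pzRingType) (phi : {rmorphism A -> B}) : Prop :=
  finite_set [set T : set B | subring_closed [in T] /\ range phi `<=` T].

(* R^p: finite functions carry the pointwise ring structure, and R^o supplies
   the diagonal R-module structure.  MathComp puts no lalgType structure on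
   them (it requires 1 != 0, which fails when p = 0), hence no {lrmorphism _}:
   an R-algebra morphism is a ring morphism which is scalable. *)
Notation rpow R p := {ffun 'I_p -> R^o}.

Definition inj_alg_morph (R : comNzRingType) (p n : nat)
    (phi : {rmorphism rpow R p -> rpow R n}) : Prop :=
  scalable phi /\ injective phi.

(* Main.v *)
Require Import Defs.
From HB Require Import structures.
From mathcomp Require Import all_boot all_order all_algebra.
From mathcomp Require Import all_classical.
From mathcomp Require Import ring zify.

(** A SPIR is local with nilpotent maximal ideal Rt, so its only idempotents
    are 0 and 1. Hence an R-algebra morphism from R^p to R^n sends each
    standard idempotent to a 0-1 vector, and is the reindexing of coordinates
    along a map f from 'I_n to 'I_p; it is injective exactly when f is
    surjective ([alg_morph_is_reindex]). Everything then depends on the sizes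
    of the fibers of f.

    If all fibers have at most two elements, an intermediate ring T is
    determined by the ideals { a | a e_j \in T }, where e_j are the standard
    idempotents of R^n: inside a fiber {j, j'} a vector is a constant plus
    (y_j' - y_j) e_j'. The ideals of R are the finitely many powers of Rt, so
    there are finitely many T ([FIP_of_small_fibers]).

    If three indices j1, j2, j3 share a fiber, let s be the last nonzero power
    of t. As s^2 = 0, for each z in Rs the vector w_z = s e_j1 + z e_j2
    satisfies w_z^2 = 0, and adjoining it to the image of R^p produces a ring
    that remembers z, the index j3 serving to separate w_z from the image of
    R^p. Since R is infinite, so is Rs ([chain_socle_infinite]), whence
    infinitely many intermediate rings ([not_FIP_of_large_fiber]).

    It remains to count. A surjective f has fibers of size at most n - p + 1
    ([fiber_card_le]), which is 2 when n = p + 1, and some fiber has more than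
    two elements when n > 2p ([exists_large_fiber]). In between, j mod p has
    fibers of size at most 2 while min(j, p - 1) has a fiber of size at least
    3. *)

Set Implicit Arguments.
Unset Strict Implicit.
Unset Printing Implicit Defensive.

Import GRing.Theory.
Local Open Scope classical_set_scope.
Local Open Scope ring_scope.

(** * Special principal ideal rings as chain rings *)

(** Krull's theorem: an ideal maximal among the proper ideals containing [a]
    is prime. Uniqueness of the prime ideal turns this into locality. *)
Lemma nonunit_in_prime (R : comNzRingType) (a : R) :
  (forall b, a * b <> 1) -> exists2 P : set R, is_prime_ideal P & P a.
Proof.
move=> a_nonunit.
pose good (X : set R) := [/\ forall c u v, X u -> X v -> X (c * u + v),
  forall c u, X u -> X (u + c * a) & ~ X 1].
(* [good] does not ask for membership of 0 or [a], so that it also holds of the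
   empty set, which is the union of the empty chain. *)
have [F F_good F_chain|A [[A_lin A_a A_1] A_max]] := @Zorn_bigcup R good.
  split.
  - move=> c u v [X FX Xu] [Y FY Yv].
    have [XY|YX] := F_chain X Y FX FY.
      exists Y => //; have [lin _ _] := F_good Y FY.
      by apply: lin => //; exact: XY.
    exists X => //; have [lin _ _] := F_good X FX.
    by apply: lin => //; exact: YX.
  - move=> c u [X FX Xu]; exists X => //.
    by have [_ Xa _] := F_good X FX; exact: Xa.
  - by move=> [X FX X1]; have [_ _] := F_good X FX.
have A0 : A 0.
  have [[x Ax]|A_empty] := pselect (exists x, A x).
    by have := A_lin (-1) _ _ Ax Ax; rewrite mulN1r addNr.
  exfalso; apply: (A_max (principal_ideal a)).
    split=> [x Ax|sub]; first by case: A_empty; exists x.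
    by apply: A_empty; exists (0 * a); apply: sub; exists 0.
  split.
  - by move=> c _ _ [x _ <-] [y _ <-]; exists (c * x + y) => //; ring.
  - by move=> c _ [x _ <-]; exists (x + c) => //; ring.
  - by move=> [x _ xa1]; apply: (a_nonunit x); rewrite mulrC.
have A_mul c u : A u -> A (c * u).
  by move=> Au; rewrite -[c * u]addr0; exact: A_lin.
have A_add u v : A u -> A v -> A (u + v).
  by move=> Au Av; rewrite -[u]mul1r; exact: A_lin.
have comaximal u : ~ A u -> exists x c, A x /\ 1 = x + c * u.
  move=> nAu; apply: contrapT => no_comb.
  apply: (A_max [set z | exists x c, A x /\ z = x + c * u]).
    split=> [x Ax|sub]; first by exists x, 0; rewrite mul0r addr0.
    by apply: nAu; apply: sub; exists 0, 1; rewrite mul1r add0r.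
  split=> //.
  - move=> c _ _ [x [d [Ax ->]]] [y [e [Ay ->]]].
    exists (c * x + y), (c * d + e); split; [exact: A_lin | by ring].
  - move=> c _ [x [d [Ax ->]]].
    exists (x + c * a), d; split; [exact: A_a | by ring].
exists A; last by have := A_a 1 0 A0; rewrite mul1r add0r.
split.
  split; rewrite ?inE //; last first.
    by move=> c u v; rewrite !inE; exact: A_lin.
  by apply/negP; rewrite inE.
move=> u v; rewrite !inE => Auv; apply/orP; rewrite !inE.
have [Au|nAu] := pselect (A u); first by left.
right; apply: contrapT => nAv.
have [x [c [Ax x_eq]]] := comaximal u nAu.
have [y [d [Ay y_eq]]] := comaximal v nAv.
apply: A_1.
have -> : 1 = (y + d * v) * x + ((c * u) * y + (c * d) * (u * v)) :> R.
  by rewrite -[LHS]mul1r {1}x_eq y_eq; ring.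
by apply: (A_add _ _ (A_mul _ _ Ax)); apply: A_add; exact: A_mul.
Qed.

Lemma ideal_exp_pow (R : comNzRingType) (t : R) k :
  ideal_exp (principal_ideal t) k (t ^+ k).
Proof.
elim: k => //= k IHk; exists 1, (fun=> t), (fun=> t ^+ k); split=> // [_|].
  by exists 1 => //; rewrite mul1r.
by rewrite big_ord1 exprS.
Qed.

Section Chain.
Variable R : comNzRingType.

(** The shape of a SPIR that the proof uses: a local ring whose maximal ideal is
    generated by a nilpotent element, of nilpotency index [k.+2] (an index of 1
    would mean that the ring is a field). *)
Definition chain_generator (t : R) k :=
  [/\ t ^+ k.+2 = 0, t ^+ k.+1 <> 0
    & forall a, (exists b, a * b = 1) \/ (exists c, a = c * t)].

Lemma SPIR_chain : SPIR R -> exists t k, chain_generator t k.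
Proof.
move=> [_ [t [_ prime_uniq tN0 [m m_exp]]]].
have t_nil : exists i, t ^+ i == 0.
  by exists m; apply/eqP; have := ideal_exp_pow t m; rewrite m_exp.
case: (ex_minnP t_nil) => k /eqP tk k_min.
have t_neq0 : t != 0.
  apply: contra_notN tN0 => /eqP ->; apply/seteqP; split=> [_ [a _ <-]|_ ->] /=.
    by rewrite mulr0.
  by exists 0 => //; rewrite mulr0.
case: k tk k_min => [|[|k]] tk k_min.
- by move: tk; rewrite expr0 => /eqP; rewrite oner_eq0.
- by move: tk; rewrite expr1 => /eqP; rewrite (negPf t_neq0).
exists t, k; split=> // [/eqP/k_min|a]; first by rewrite ltnn.
have [?|a_nonunit] := pselect (exists b, a * b = 1); [by left | right].
have [|P /prime_uniq -> [c _ <-]] := @nonunit_in_prime R a; last by exists c.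
by move=> b ab; apply: a_nonunit; exists b.
Qed.

Variables (t : R) (k : nat).
Hypothesis t_chain : chain_generator t k.

Lemma chain_idempotent (e : R) : e * e = e -> e = 0 \/ e = 1.
Proof.
case: t_chain => tk _ dich ee.
have [[b eb]|[c ec]] := dich e.
  by right; rewrite -[e]mulr1 -eb mulrA ee.
left; have epow i : e ^+ i.+1 = e by elim: i => // i IHi; rewrite exprS IHi.
by rewrite -(epow k.+1) ec exprMn tk mulr0.
Qed.

(** A division algorithm by [t]: either [t] divides [z] [i] times, or the
    division stops earlier, which can only happen at a unit. *)
Lemma chain_factor (z : R) i : (exists c, z = c * t ^+ i) \/
  exists j u v, [/\ (j < i)%N, u * v = 1 & z = u * t ^+ j].
Proof.
case: t_chain => _ _ dich.
elim: i => [|i [[c zc]|[j [u [v [ji uv zu]]]]]].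
- by left; exists z; rewrite expr0 mulr1.
- have [[b cb]|[d cd]] := dich c.
    by right; exists i, c, b.
  by left; exists d; rewrite zc cd exprS mulrA.
- by right; exists j, u, v; split=> //; exact: ltnW.
Qed.

Lemma chain_ideal (I : set R) : principal_ideal_ring R -> is_ideal I ->
  exists i : 'I_k.+3, I = principal_ideal (t ^+ i).
Proof.
move=> pir /pir [d ->].
case: t_chain => tk _ _.
have [[c dc]|[j [u [v [jk uv du]]]]] := chain_factor d k.+2.
  by exists ord_max; rewrite dc tk mulr0.
exists (Ordinal (leqW jk)); apply/seteqP; split=> _ [a _ <-] /=.
  by exists (a * u) => //; rewrite du mulrA.
exists (a * v) => //.
by rewrite du -mulrA [v * _]mulrA [v * u]mulrC uv mul1r.
Qed.

Lemma chain_annihilator (z : R) : z * t = 0 -> principal_ideal (t ^+ k.+1) z.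
Proof.
case: t_chain => tk tkN0 _ zt.
have [[c ->]|[j [u [v [jk uv zu]]]]] := chain_factor z k.+1; first by exists c.
case: tkN0; rewrite -(subnKC jk) exprD exprSr -[t ^+ j]mul1r -uv [u * v]mulrC.
by rewrite -[v * u * _]mulrA -zu -[v * z * _]mulrA zt mulr0 mul0r.
Qed.

(** The socle [R t^(k+1)] is the annihilator of [t]. Were it finite, the
    annihilator of every power of [t] would be finite by induction, since
    multiplication by [t] maps the annihilator of [t^(i+1)] to that of [t^i]
    with fibers that are cosets of the socle; but [t^(k+2)] kills all of R. *)
Lemma chain_socle_infinite : infinite_set [set: R] ->
  infinite_set (principal_ideal (t ^+ k.+1)).
Proof.
move=> R_inf socle_fin; apply: R_inf.
have [g g_div] : {g : R -> R & forall y, (exists z, z * t = y) -> g y * t = y}.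
  apply: (@choice R R (fun y x => (exists z, z * t = y) -> x * t = y)) => y.
  have [[z zy]|ny] := pselect (exists z, z * t = y).
    by exists z.
  by exists 0.
have ann_fin i : finite_set [set z | z * t ^+ i = 0].
  elim: i => [|i IHi].
    apply: (sub_finite_set _ (finite_set1 0)) => z /=.
    by rewrite expr0 mulr1.
  apply: (sub_finite_set _ (finite_image2 (fun y w => g y + w) IHi socle_fin)).
  move=> z /= zt; exists (z * t); first by rewrite -mulrA -exprS.
  exists (z - g (z * t)); last by rewrite addrC subrK.
  by apply: chain_annihilator; rewrite mulrBl g_div ?subrr //; exists z.
apply: (sub_finite_set _ (ann_fin k.+2)) => z _ /=.
by case: t_chain => -> _ _; rewrite mulr0.
Qed.

End Chain.

(** * Algebra morphisms between finite powers *)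

Section Reindex.
Variables (R : comNzRingType) (p n : nat) (f : 'I_n -> 'I_p).

Definition reindex (x : rpow R p) : rpow R n := [ffun j => x (f j)].

Fact reindex_is_zmod_morphism : zmod_morphism reindex.
Proof. by move=> x y; apply/ffunP => j; rewrite !ffunE. Qed.

Fact reindex_is_monoid_morphism : monoid_morphism reindex.
Proof. by split=> [|x y]; apply/ffunP => j; rewrite !ffunE. Qed.

HB.instance Definition _ :=
  GRing.isZmodMorphism.Build (rpow R p) (rpow R n) reindex
    reindex_is_zmod_morphism.
HB.instance Definition _ :=
  GRing.isMonoidMorphism.Build (rpow R p) (rpow R n) reindex
    reindex_is_monoid_morphism.

Definition reindex_rmorphism : {rmorphism rpow R p -> rpow R n} := reindex.

Lemma reindex_inj_alg_morph :
  (forall i, exists j, f j = i) -> inj_alg_morph reindex_rmorphism.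
Proof.
move=> f_surj; split=> [a x|x y xy].
  by apply/ffunP => j; rewrite !ffunE.
apply/ffunP => i; have [j <-] := f_surj i.
by have := congr1 (fun z : rpow R n => z j) xy; rewrite !ffunE.
Qed.

End Reindex.

Definition unit_vector (R : comNzRingType) m (i : 'I_m) : rpow R m :=
  [ffun i' => (i' == i)%:R].

(** At a coordinate [j], the values of [phi] on the unit vectors are idempotents
    of R of sum 1, so one of them, of index [i] say, is 1. Applying [phi] to
    [x * d i = x i *: d i] then gives [phi x j = x i]. *)
Lemma alg_morph_is_reindex (R : comNzRingType) p n
    (phi : {rmorphism rpow R p -> rpow R n}) :
  (forall e : R, e * e = e -> e = 0 \/ e = 1) -> inj_alg_morph phi ->
  exists f : 'I_n -> 'I_p,
    (forall x j, phi x j = x (f j)) /\ (forall i, exists j, f j = i).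
Proof.
move=> idem [phi_lin phi_inj].
pose d i := unit_vector R i : rpow R p.
have d_idem i : d i * d i = d i.
  by apply/ffunP => i'; rewrite !ffunE -natrM mulnb andbb.
have d_mul x i : x * d i = x i *: d i.
  apply/ffunP => i'; rewrite !ffunE.
  by case: eqP => [->|_]; rewrite ?mulr0 // /GRing.scale /= mulr0.
have d_sum : \sum_i d i = 1.
  apply/ffunP => i'; rewrite sum_ffunE !ffunE (bigD1 i') //= ffunE eqxx.
  by rewrite big1 ?addr0 // => i /negPf ii'; rewrite ffunE eq_sym ii'.
have phi_d j : exists i, phi (d i) j = 1.
  apply: contrapT => no_i; have /eqP := oner_neq0 R; apply.
  have -> : 1 = phi 1 j by rewrite rmorph1 ffunE.
  rewrite -d_sum raddf_sum sum_ffunE big1 // => i _.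
  have dd : phi (d i) j * phi (d i) j = phi (d i) j.
    by rewrite -[in RHS]d_idem rmorphM ffunE.
  by have [//|d1] := idem _ dd; case: no_i; exists i.
have [f f_d] := choice phi_d.
have phiE x j : phi x j = x (f j).
  have := congr1 (fun y : rpow R n => y j) (rmorphM phi x (d (f j))).
  by rewrite d_mul phi_lin !ffunE f_d /GRing.scale /= !mulr1.
exists f; split=> // i; apply: contrapT => no_j.
have /phi_inj : phi (d i) = phi 0.
  apply/ffunP => j; rewrite !phiE !ffunE.
  by case: eqP => // fj; case: no_j; exists j.
move/(congr1 (fun x : rpow R p => x i)); rewrite !ffunE eqxx.
exact/eqP/oner_neq0.
Qed.

(** * Intermediate rings and fibers *)

Section Fibers.
Variables (R : comNzRingType) (t : R) (k : nat).
Hypothesis t_chain : chain_generator t k.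
Variables (p n : nat) (phi : {rmorphism rpow R p -> rpow R n}).
Variable f : 'I_n -> 'I_p.
Hypothesis phiE : forall x j, phi x j = x (f j).

(** An intermediate ring [T] is recovered from the exponents [c j] of the ideals
    [{a | a d_j \in T}]: it consists of the [y] whose differences
    [y j' - y j] within a fiber lie in the ideal attached to [j']. One inclusion
    writes [y] as a vector constant on fibers plus multiples of the [d j]. The
    other one needs the fibers to be small: if [j <> j'] form a whole fiber,
    then subtracting the constant [y j] and cutting out that fiber isolates
    [(y j' - y j) d_j']. *)
Lemma FIP_of_small_fibers : principal_ideal_ring R ->
  (forall i, exists j, f j = i) ->
  (forall i, (#|[pred j | f j == i]| <= 2)%N) -> FIP phi.
Proof.
move=> pir f_surj small.
(* [s i] is a base point of the fiber over [i]. *)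
have [s fs] := choice f_surj.
pose subring_of (c : {ffun 'I_n -> 'I_k.+3}) : set (rpow R n) :=
  [set y | forall j j', f j = f j' ->
             principal_ideal (t ^+ c j') (y j' - y j)].
suff sub : [set T : set (rpow R n) | subring_closed [in T] /\ range phi `<=` T]
    `<=` range subring_of.
  apply: (sub_finite_set sub); apply: finite_image.
  exact: (@finite_finset {ffun 'I_n -> 'I_k.+3}).
move=> T [[T1 TB TM] phiT] /=.
have {T1}T1 : T 1 by move: T1; rewrite inE.
have {}TB x y : T x -> T y -> T (x - y).
  by move=> Tx Ty; have := TB x y; rewrite !inE; exact.
have {}TM x y : T x -> T y -> T (x * y).
  by move=> Tx Ty; have := TM x y; rewrite !inE; exact.
have T0 : T 0 by rewrite -(subrr 1); exact: TB.
have TD x y : T x -> T y -> T (x + y).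
  move=> Tx Ty; rewrite -[y]opprK -[- y]sub0r.
  exact: (TB _ _ Tx (TB _ _ T0 Ty)).
have Tphi x : T (phi x) by apply: phiT; exists x.
pose d j := unit_vector R j : rpow R n.
have dZ a b j : (a * b) *: d j = phi [ffun=> a] * (b *: d j).
  by apply/ffunP => j'; rewrite !(ffunE, phiE) -[LHS]mulrA.
have d_ideal j : is_ideal [set a | T (a *: d j)].
  split; first by rewrite inE /= scale0r.
  move=> a u v; rewrite !inE /= => Tu Tv.
  by rewrite scalerDl; apply: TD => //; rewrite dZ; exact: TM.
have [c cE] := choice (fun j => chain_ideal t_chain pir (d_ideal j)).
have {}cE a j : principal_ideal (t ^+ c j) a <-> T (a *: d j) by rewrite -cE.
exists [ffun j => c j] => //; apply/seteqP; split=> y /= Hy.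
  have -> : y = phi [ffun i => y (s i)] +
                \sum_j (y j - y (s (f j))) *: d j.
    apply/ffunP => j; rewrite ffunE phiE ffunE sum_ffunE (bigD1 j) //=.
    rewrite big1 => [|j' /negPf jj']; rewrite !ffunE.
      by rewrite eqxx addr0 [_ *: _]mulr1 addrC subrK.
    by rewrite eq_sym jj' [_ *: _]mulr0.
  apply: (TD) => //; apply: (big_ind T) => // j _.
  by apply/cE; have := Hy (s (f j)) j (fs _); rewrite ffunE.
move=> j j' fjj'; rewrite ffunE; apply/cE.
have [<-|jj'] := eqVneq j j'; first by rewrite subrr scale0r.
have -> : (y j' - y j) *: d j' =
    (y - phi [ffun=> y j]) * phi (unit_vector R (f j)).
  apply/ffunP => l; rewrite !(ffunE, phiE) -[LHS]/(_ * _).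
  have [->|jl] := eqVneq l j'; first by rewrite fjj' eqxx.
  have [flj|] := eqVneq (f l) (f j); last by rewrite !mulr0.
  have [->|lj] := eqVneq l j; first by rewrite subrr mulr0 mul0r.
  exfalso; have := small (f j); rewrite leqNgt => /negP; apply.
  apply/card_gt2P; exists j, j', l; rewrite !inE flj -fjj' !eqxx.
  by rewrite jj' lj eq_sym jl.
by apply: TM => //; exact: TB.
Qed.

(** For [z] in the socle [R s], where [s = t^(k+1)], the ring [T z] is the image
    of [phi] with [w z] adjoined. If [w z] equals [phi x + phi c * w z'],
    comparing the coordinates [j3], [j1] and [j2] yields [x = 0], [s = c * s]
    and [z = c * z'] at the common fiber index; the last product is [z'] because
    [z'] is a multiple of [s]. *)
Lemma not_FIP_of_large_fiber (j1 j2 j3 : 'I_n) : infinite_set [set: R] ->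
  [/\ f j1 = f j3 & f j2 = f j3] -> [/\ j1 != j2, j2 != j3 & j3 != j1] ->
  ~ FIP phi.
Proof.
move=> R_inf [f1 f2] [/negPf j12 /negPf j23 /negPf j31].
have [tk _ _] := t_chain.
set s := t ^+ k.+1.
have ss : s * s = 0 by rewrite -exprD addSnnS addnC exprD tk mul0r.
have [w wE] : exists w : R -> rpow R n, forall z j,
    w z j = if j == j1 then s else if j == j2 then z else 0.
  exists (fun z =>
    [ffun j => if j == j1 then s else if j == j2 then z else 0]) => z j.
  by rewrite ffunE.
have ww z j : principal_ideal s z -> w z j * w z j = 0.
  move=> [a _ <-]; rewrite wE; case: eqP => // _.
  by case: eqP => _; rewrite ?mulr0 // mulrACA ss mulr0.
pose T z : set (rpow R n) :=
  [set y | exists x c : rpow R p, y = phi x + phi c * w z].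
have T_inj : {in principal_ideal s &, injective T}.
  move=> z z'; rewrite !inE => _ [a _ sz'] TT.
  have [x [c wzE]] : T z' (w z).
    by rewrite -TT; exists 0, 1; rewrite rmorph0 rmorph1 add0r mul1r.
  have wj j : w z j = x (f j) + c (f j) * w z' j by rewrite wzE !ffunE !phiE.
  have x0 : x (f j3) = 0.
    by have := wj j3; rewrite !wE j31 eq_sym j23 mulr0 addr0.
  have := wj j1; rewrite f1 x0 !wE eqxx add0r => cs.
  have := wj j2; rewrite f2 x0 !wE eqxx eq_sym j12 add0r => ->.
  by rewrite -sz' mulrCA -cs.
have T_sub z : principal_ideal s z ->
    subring_closed [in T z] /\ range phi `<=` T z.
  move=> sz; split; last first.
    by move=> _ [x _ <-]; exists x, 0; rewrite rmorph0 mul0r addr0.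
  split.
  - by rewrite inE; exists 1, 0; rewrite rmorph1 rmorph0 mul0r addr0.
  - move=> u v; rewrite !inE => -[x [c ->]] [y [d ->]]; exists (x - y), (c - d).
    by rewrite !rmorphB mulrBl opprD addrACA.
  - move=> u v; rewrite !inE => -[x [c ->]] [y [d ->]].
    exists (x * y), (c * y + x * d).
    apply/ffunP => j; rewrite !(ffunE, phiE).
    (* The two sides differ by the term in the square of [w z]. *)
    rewrite -[RHS]addr0 -(mulr0 (c (f j) * d (f j))) -(ww z j sz).
    ring.
move=> fin; apply: (chain_socle_infinite t_chain R_inf).
have /eq_finite_set <- := inj_card_eq T_inj.
apply: (sub_finite_set _ fin) => _ [z sz <-].
exact: T_sub.
Qed.

End Fibers.

(** * Counting fibers *)

(** The [p - 1] other fibers are nonempty and fit in the complement. *)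
Lemma fiber_card_le n p (f : 'I_n -> 'I_p) i :
  (forall i, exists j, f j = i) -> (#|[pred j | f j == i]| + p <= n.+1)%N.
Proof.
move=> f_surj; have [s fs] := choice f_surj.
have s_inj : injective s by exact: can_inj fs.
have others : (p.-1 <= #|[predC [pred j | f j == i]]|)%N.
  rewrite -[p in p.-1]card_ord -(cardC1 i) -(fintype.card_image s_inj).
  apply: subset_leq_card; apply/fintype.subsetP => j /fintype.imageP[i' i'i ->].
  by rewrite !inE fs.
have p_gt0 : (0 < p)%N by exact: leq_ltn_trans (ltn_ord i).
have : (#|[pred j | f j == i]| + p.-1 <= n)%N.
  by rewrite -[n in (_ <= n)%N]card_ord -(cardC [pred j | f j == i]) leq_add2l.
by rewrite -ltnS -addnS prednK.
Qed.

Lemma exists_large_fiber n p (f : 'I_n -> 'I_p) (m : nat) :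
  (m * p < n)%N -> exists i, (m < #|[pred j | f j == i]|)%N.
Proof.
move=> mp_n; apply: contrapT => no_i.
move: mp_n; rewrite ltnNge => /negP; apply.
rewrite -[n in (n <= _)%N]card_ord -sum1_card (partition_big f predT) //=.
rewrite -[p in (_ * p)%N]card_ord mulnC -sum_nat_const leq_sum // => i _.
rewrite sum1_card leqNgt; apply/negP => large; apply: no_i; exists i.
exact: large.
Qed.

Lemma fiber_modn_le2 n p (p_gt0 : (0 < p)%N) (i : 'I_p) : (n <= 2 * p)%N ->
  (#|[pred j : 'I_n | Ordinal (ltn_pmod j p_gt0) == i]| <= 2)%N.
Proof.
move=> n_le; rewrite leqNgt; apply/negP => /card_gt2P [x [y [z]]].
case=> -[]; rewrite !inE -!val_eqE /= => /eqP xi /eqP yi /eqP zi.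
move=> [/eqP xy /eqP yz /eqP zx].
have half (u : 'I_n) : (u %/ p < 2)%N.
  by rewrite ltn_divLR //; apply: leq_trans n_le.
have := half x; have := half y; have := half z.
have := divn_eq x p; have := divn_eq y p; have := divn_eq z p.
rewrite xi yi zi.
case: (x %/ p)%N => [|[|//]]; case: (y %/ p)%N => [|[|//]];
  case: (z %/ p)%N => [|[|//]] *; lia.
Qed.

(** * The three ranges of n *)

Theorem proposition4p6 (R : comNzRingType) (p n : nat)
    (R_inf : infinite_set [set: R]) (R_spir : SPIR R) (p_gt1 : (1 < p)%N)
    (p_lt_n : (p < n)%N) :
  [/\ n = p.+1 ->
        forall phi : {rmorphism rpow R p -> rpow R n},
          inj_alg_morph phi -> FIP phi,
      (p + 2 <= n <= 2 * p)%N ->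
        (exists phi : {rmorphism rpow R p -> rpow R n},
           inj_alg_morph phi /\ FIP phi) /\
        (exists phi : {rmorphism rpow R p -> rpow R n},
           inj_alg_morph phi /\ ~ FIP phi)
    & (2 * p + 1 <= n)%N ->
        forall phi : {rmorphism rpow R p -> rpow R n},
          inj_alg_morph phi -> ~ FIP phi].
Proof.
have [pir _] := R_spir.
have [t [k t_chain]] := SPIR_chain R_spir.
have shape := alg_morph_is_reindex (chain_idempotent t_chain).
split=> [n_eq phi /shape [f [phiE f_surj]]|/andP[p2_le n_le]|
         n_ge phi /shape [f [phiE _]]].
- apply: (FIP_of_small_fibers t_chain phiE) => // i.
  by have := fiber_card_le i f_surj; lia.
- have p_gt0 : (0 < p)%N by exact: ltnW.
  split.
    pose f (j : 'I_n) : 'I_p := Ordinal (ltn_pmod j p_gt0).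
    have f_surj i : exists j, f j = i.
      exists (widen_ord (ltnW p_lt_n) i); apply: val_inj.
      by rewrite /= modn_small.
    exists (reindex_rmorphism R f); split; first exact: reindex_inj_alg_morph.
    apply: (FIP_of_small_fibers (f := f) t_chain) => // [x j|i].
      by rewrite ffunE.
    exact: fiber_modn_le2.
  (* The fiber of [f] over [p - 1] contains [p - 1], [p] and [p + 1]. *)
  have cap_lt j : (minn j p.-1 < p)%N by rewrite gtn_min prednK ?leqnn ?orbT.
  pose f (j : 'I_n) : 'I_p := Ordinal (cap_lt j).
  have f_surj i : exists j, f j = i.
    exists (widen_ord (ltnW p_lt_n) i); apply: val_inj => /=.
    by apply/minn_idPl; rewrite -ltnS prednK.
  exists (reindex_rmorphism R f); split; first exact: reindex_inj_alg_morph.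
  have lt1 : (p.-1 < n)%N by lia.
  have lt3 : (p.+1 < n)%N by lia.
  apply: (@not_FIP_of_large_fiber R t k t_chain _ _ _ f _
            (Ordinal lt1) (Ordinal p_lt_n) (Ordinal lt3)) => //.
  + by move=> x j; rewrite ffunE.
  + by split; apply: val_inj => /=; lia.
  + by split; rewrite -val_eqE /=; lia.
- have mp_n : (2 * p < n)%N by lia.
  have [i /card_gt2P [x [y [z [[fx fy fz] xyz]]]]] :=
    exists_large_fiber f mp_n.
  move: fx fy fz; rewrite !inE => /eqP fx /eqP fy /eqP fz.
  by apply: (not_FIP_of_large_fiber t_chain phiE R_inf _ xyz); rewrite fx fy fz.
Qed.
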